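(* For the permanent of the generic symmetric $n\times n$ matrix $X$, $$\frac{\binom{2n}{n}+2^n}{6}\le cr(\mathrm{perm}(X))\le sr(\mathrm{perm}(X))\le r(\mathrm{perm}(X)).$$
   Context: Let $\mathsf k$ be an infinite field of characteristic zero or characteristic $p>2$. $X=(x_{ij})$ is the generic symmetric $n\times n$ matrix: its entries $x_{ij}=x_{ji}$, $1\le i\le j\le n$, are $n(n+1)/2$ distinct variables; $\mathrm{perm}(X)$ is its permanent. $R=\mathsf k[x_{ij}: i\le j]$, $S=\mathsf k[y_{ij}: i\le j]$, and $S$ acts on $R$ by differentiation ($y_{ij}$ acts as $\partial/\partial x_{ij}$; action written $h\circ F$). $\mathrm{Ann}(F)=\{h\in S: h\circ F=0\}$. The action makes $S$ the homogeneous coordinate ring of the projective space $\mathbf P(R_1)$ of one-dimensional subspaces of $R_1$; a closed subscheme $\Gamma\subset\mathbf P(R_1)$ has homogeneous ideal $I_\Gamma\subset S$. For a homogeneous form $F\in R$ define: - rank: $r(F)=\min\{\deg\Gamma:\Gamma\subset\mathbf P(R_1)\text{ smooth},\ \dim\Gamma=0,\ I_\Gamma\subset\mathrm{Ann}(F)\}$; - smoothable rank: $sr(F)=\min\{\deg\Gamma:\Gamma\subset\mathbf P(R_1)\text{ smoothable},\ \dim\Gamma=0,\ I_\Gamma\subset\mathrm{Ann}(F)\}$, where smoothable means that $\Gamma$ is a limit of smooth schemes of $s=\deg\Gamma$ simple points; - cactus rank: $cr(F)=\min\{\deg\Gamma:\Gamma\subset\mathbf P(R_1),\ \dim\Gamma=0,\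 I_\Gamma\subset\mathrm{Ann}(F)\}$. Here $\deg\Gamma$ is the length of the zero-dimensional scheme $\Gamma$. *)

(* Defs.v *)
From HB Require Import structures.
From mathcomp Require Import all_boot all_order all_algebra all_fingroup.
From mathcomp Require Export mpoly.

Set Implicit Arguments.
Unset Strict Implicit.
Unset Printing Implicit Defensive.

Import GRing.Theory.
Local Open Scope ring_scope.

Definition permanent (T : comNzRingType) (n : nat) (A : 'M[T]_n) : T :=
  \sum_(s : 'S_n) \prod_(i < n) A i (s i).

(* The pairs i <= j index the variables x_ij. *)
Definition symidx (n : nat) := {p : 'I_n * 'I_n | (p.1 <= p.2)%N}.

Definition sort_pair (n : nat) (i j : 'I_n) : 'I_n * 'I_n :=
  if (i <= j)%N then (i, j) else (j, i).

Lemma sort_pairP (n : nat) (i j : 'I_n) :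
  ((sort_pair i j).1 <= (sort_pair i j).2)%N.
Proof. by rewrite /sort_pair; case: ifP => //= /negbT; rewrite -ltnNge => /ltnW. Qed.

Definition symvar (n : nat) (i j : 'I_n) : 'I_#|{: symidx n}| :=
  enum_rank (exist _ (sort_pair i j) (sort_pairP i j) : symidx n).

Definition generic_sym_mx (k : fieldType) (n : nat) :
  'M[{mpoly k[#|{: symidx n}|]}]_n := \matrix_(i, j) 'X_(symvar i j).

Section Apolarity.
Variables (k : fieldType) (N : nat).
Implicit Types h F : {mpoly k[N]}.

(* S and R are both {mpoly k[N]}; the i-th variable of S acts on R as the
   derivative with respect to the i-th variable. *)
Definition diffact h F : {mpoly k[N]} :=
  \sum_(m <- msupp h) h@_m *: F^`M[m].

Definition Ann F h : Prop := diffact h F = 0.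

End Apolarity.

Section HomogeneousIdeals.
Variables (A : comNzRingType) (N : nat).
Implicit Types (I : {mpoly A[N]} -> Prop) (g h : {mpoly A[N]}).

Definition is_ideal I : Prop :=
  [/\ I 0,
      (forall g h, I g -> I h -> I (g + h))
    & (forall g h, I h -> I (g * h))].

Definition homogeneous_ideal I : Prop :=
  is_ideal I /\ (forall h, I h -> forall d : nat, I (pihomog mdeg d h)).

Definition saturated I : Prop :=
  forall h, (exists e : nat, forall g, g \is e.-homog -> I (g * h)) -> I h.

(* The degree d part of A[y]/I is a free A-module of rank s (over a field: a
   vector space of dimension s). *)
Definition quot_free_rank I (d s : nat) : Prop :=
  exists b : 'I_s -> {mpoly A[N]},
    (forall i, b i \is d.-homog) /\
    (forall h, h \is d.-homog ->
       exists! c : {ffun 'I_s -> A}, I (h - \sum_(i < s) c i *: b i)).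

End HomogeneousIdeals.

(* The ideal generated by the image of I under a change of base ring. *)
Definition extend_ideal (A B : comNzRingType) (N : nat) (f : {rmorphism A -> B})
    (I : {mpoly A[N]} -> Prop) (h : {mpoly B[N]}) : Prop :=
  exists (r : nat) (a : 'I_r -> {mpoly B[N]}) (g : 'I_r -> {mpoly A[N]}),
    (forall i, I (g i)) /\ h = \sum_(i < r) a i * map_mpoly f (g i).

(* Closed subschemes of P^(N-1) over k correspond bijectively to saturated
   homogeneous ideals of the coordinate ring. *)
Record closed_subscheme (k : fieldType) (N : nat) := ClosedSubscheme {
  ideal_of :> {mpoly k[N]} -> Prop;
  _ : homogeneous_ideal ideal_of;
  _ : saturated ideal_of
}.

Section ZeroDimensional.
Variables (k : fieldType) (N : nat).

(* A subscheme has dimension 0 iff its Hilbert polynomial is a nonzero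
   constant, and then that constant is its length: dim H^0(O(d)) = dim H^0(O)
   agrees with the Hilbert function for large d.  The condition 0 < s excludes
   the empty scheme. *)
Definition zero_dim_of_degree (G : closed_subscheme k N) (s : nat) : Prop :=
  (0 < s)%N /\
  exists d0 : nat, forall d : nat, (d0 <= d)%N -> quot_free_rank G d s.

(* Smoothness over k of the zero-dimensional scheme defined by I: at every
   geometric point p the Zariski tangent space is 0.  In homogeneous
   coordinates, the tangent space of the affine cone over the scheme at p is
   the line through p.  All field extensions L of k are considered, so that
   this is smoothness and not only regularity. *)
Definition smooth0 (I : {mpoly k[N]} -> Prop) : Prop :=
  forall (L : fieldType) (f : {rmorphism k -> L}) (p : 'I_N -> L),
    (exists i, p i != 0) ->
    (forall h, I h -> (map_mpoly f h).@[p] = 0) ->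
    forall v : 'I_N -> L,
      (forall h, I h -> \sum_(i < N) v i * (mderiv i (map_mpoly f h)).@[p] = 0) ->
      exists c : L, forall i, v i = c * p i.

End ZeroDimensional.

(* G lies in the closure of the locus of smooth schemes in the Hilbert scheme of
   length s subschemes: there is a flat family over an integral affine base
   Spec A whose generic fibre is smooth and whose fibre at some k-point ev is G.
   The base may be taken local, so flatness of the family says that the graded
   pieces of A[y]/J of large degree are free, of rank s. A subscheme is
   determined by its ideal in large degrees, whence the condition on the
   special fibre, the ideal of which need not be saturated. *)
Definition smoothable (k : fieldType) (N : nat) (G : closed_subscheme k N)
    (s : nat) : Prop :=
  exists (A : idomainType) (iota : {rmorphism k -> A}) (ev : {rmorphism A -> k})
         (J : {mpoly A[N]} -> Prop) (d0 : nat),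
  [/\ cancel iota ev,
      homogeneous_ideal J,
      (forall d : nat, (d0 <= d)%N -> quot_free_rank J d s),
      (forall d : nat, (d0 <= d)%N -> forall h, h \is d.-homog ->
         (extend_ideal ev J h <-> G h))
    & smooth0 (extend_ideal (@FracField.tofrac A) J)].

Section Ranks.
Variables (k : fieldType) (N : nat).
Implicit Types (F : {mpoly k[N]}) (G : closed_subscheme k N).

Definition is_min (P : nat -> Prop) (m : nat) : Prop :=
  P m /\ (forall s, P s -> (m <= s)%N).

Definition apolar F G : Prop := forall h, G h -> Ann F h.

Definition is_rank F : nat -> Prop :=
  is_min (fun s => exists G, [/\ zero_dim_of_degree G s, smooth0 G & apolar F G]).

Definition is_smoothable_rank F : nat -> Prop :=
  is_min (fun s => exists G,
    [/\ zero_dim_of_degree G s, smoothable G s & apolar F G]).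

Definition is_cactus_rank F : nat -> Prop :=
  is_min (fun s => exists G, zero_dim_of_degree G s /\ apolar F G).

End Ranks.

(* Main.v *)
Require Import Defs.
From HB Require Import structures.
From mathcomp Require Import all_boot all_order all_algebra all_fingroup.
From mathcomp Require Import ssrcomplements.
From mathcomp Require Import ring.
From Stdlib Require Import Classical.

(** The upper bounds are formal: a smooth scheme is the special fibre of a
    constant family, so rank, smoothable rank and cactus rank minimise over
    increasing sets of schemes, and it only has to be seen that some smooth
    scheme is apolar to the permanent F ([exists_smooth_apolar]).  Over an infinite field there is a
    finite set of rational points that lies on no hypersurface of degree at
    most n; its ideal starts in degree n + 1, where all operators annihilate F.

    The lower bound combines three facts about a saturated ideal I that is
    contained in the apolar ideal of F and defines a scheme of length c.

    First, the apolar ideal contains the cubes of all variables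
    ([Ann_permanent_cube]), as each index occurs once as a row and once as a
    column in a term of F.  These cubes have no common zero, so a suitable linear
    combination g of them is regular modulo I ([exists_regular_cubic]): the
    determinant of multiplication by y_1^3 + t y_2^3 + t^2 y_3^3 + ... between
    two large degrees is a polynomial in t, and by McCoy's theorem it is
    nonzero.

    Second, the quotient by I + (g) has dimension at most 3 c, and it maps onto
    the quotient by the apolar ideal.  Hence the dimension of the latter, the
    space of all derivatives of F, is at most 3 c ([upair_leq_length]).

    Third, this space has dimension at least the number of unordered pairs
    {I, J} of subsets of the index set with the same size.  Indeed every
    subpermanent of X is a derivative of F ([exists_strikes]): modulo
    derivatives already obtained, exchanging an index of I with one of J changes
    the sign of the subpermanent that lacks the rows I and the columns J, and a
    cycle of three exchanges shows that twice this subpermanent is a derivative;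
    this is where 2 must be invertible.
    The operators for complementary pairs are dual to each other
    ([catalecticant_independent]).

    Ordered pairs of equicardinal subsets number binomial(2 n, n) by
    Vandermonde, and 2 ^ n of them are diagonal, so that the number of unordered
    pairs is half of binomial(2 n, n) + 2 ^ n ([card_upair]). *)

Set Implicit Arguments.
Unset Strict Implicit.
Unset Printing Implicit Defensive.

Import Order.TTheory GRing.Theory Num.Theory.
Local Open Scope ring_scope.

(** * Constant coefficient operators *)

Section Differentiation.
Variables (k : fieldType) (N : nat).
Implicit Types g h F G : {mpoly k[N]}.

Lemma diffactwE h F w : (msize h <= w)%N ->
  diffact h F = \sum_(m : 'X_{1..N < w}) h@_m *: F^`M[m].
Proof.
move=> le_hw; rewrite /diffact (big_mksub 'X_{1..N < w}) ?msupp_uniq //=.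
  by rewrite big_rmcond //= => m /memN_msupp_eq0 ->; rewrite scale0r.
by move=> m /msize_mdeg_lt /leq_trans; apply.
Qed.

Lemma diffactDl F : {morph (fun h => diffact h F) : g h / g + h}.
Proof.
move=> g h; set w := maxn (msize (g + h)) (maxn (msize g) (msize h)).
rewrite !(@diffactwE _ F w) /w ?leq_max ?leqnn ?orbT // -big_split /=.
by apply: eq_bigr => m _; rewrite mcoeffD scalerDl.
Qed.

Lemma diffactZl c h F : diffact (c *: h) F = c *: diffact h F.
Proof.
rewrite (diffactwE F (msizeZ_le h c)) (diffactwE F (leqnn _)) scaler_sumr.
by apply: eq_bigr => m _; rewrite mcoeffZ scalerA.
Qed.

Lemma diffact0l F : diffact 0 F = 0.
Proof. by rewrite -(scale0r (0 : {mpoly k[N]})) diffactZl !scale0r. Qed.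

Lemma diffact_suml (I : Type) (r : seq I) (P : pred I) (u : I -> {mpoly k[N]}) F :
  diffact (\sum_(i <- r | P i) u i) F = \sum_(i <- r | P i) diffact (u i) F.
Proof. exact: (big_morph (fun h => diffact h F) (diffactDl F) (diffact0l F)). Qed.

Lemma diffactDr h : {morph diffact h : F G / F + G}.
Proof.
move=> F G; rewrite /diffact -big_split /=; apply: eq_bigr => m _.
by rewrite mderivmD scalerDr.
Qed.

Lemma diffactZr c h F : diffact h (c *: F) = c *: diffact h F.
Proof.
rewrite /diffact scaler_sumr; apply: eq_bigr => m _.
by rewrite mderivmZ !scalerA mulrC.
Qed.

Lemma diffact0r h : diffact h 0 = 0.
Proof. by rewrite -(scale0r (0 : {mpoly k[N]})) diffactZr !scale0r. Qed.

Lemma diffact_sumr (I : Type) (r : seq I) (P : pred I) (u : I -> {mpoly k[N]}) h :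
  diffact h (\sum_(i <- r | P i) u i) = \sum_(i <- r | P i) diffact h (u i).
Proof. exact: (big_morph (diffact h) (diffactDr h) (diffact0r h)). Qed.

Lemma diffactXm m F : diffact 'X_[m] F = F^`M[m].
Proof. by rewrite /diffact msuppX big_seq1 mcoeffX eqxx scale1r. Qed.

Lemma diffactX i F : diffact 'X_i F = F^`M(i).
Proof. by rewrite diffactXm mderivmU1m. Qed.

Lemma diffact1 F : diffact 1 F = F.
Proof. by rewrite -mpolyX0 diffactXm mderivm0m. Qed.

(** Constant coefficient operators commute, so R becomes a module over the
    ring of symbols, and apolar ideals are ideals. *)
Lemma diffactM g h F : diffact (g * h) F = diffact g (diffact h F).
Proof.
elim/mpolyind: g => [|c m g _ _ IH]; first by rewrite mul0r !diffact0l.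
rewrite mulrDl !diffactDl IH -scalerAl !diffactZl; congr (_ *: _ + _).
clear IH; elim/mpolyind: h => [|c' m' h _ _ IHh].
  by rewrite mulr0 !diffact0l diffact0r.
rewrite mulrDr !diffactDl IHh diffactDr -scalerAr !diffactZl diffactZr.
by rewrite -mpolyXD !diffactXm addmC mderivmDm.
Qed.

Lemma Ann_mull F g h : Ann F h -> Ann F (g * h).
Proof. by move=> Fh; rewrite /Ann diffactM Fh diffact0r. Qed.

Lemma Ann_gt_deg F n h : F \is n.-homog ->
  (forall m, m \in msupp h -> (n < mdeg m)%N) -> Ann F h.
Proof.
move=> hF hh; rewrite /Ann /diffact big_seq big1 // => m /hh ltn_m.
suff -> : F^`M[m] = 0 by rewrite scaler0.
apply/mpolyP => m'; rewrite mcoeff_mderivm mcoeff0.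
suff ne_mn: mdeg (m + m')%MM != n by rewrite (dhomog_nemf_coeff hF ne_mn) mul0rn.
by rewrite mdegD neq_ltn (ltn_addr _ ltn_m) orbT.
Qed.

End Differentiation.

(** * Derivatives of the permanent are combinations of subpermanents *)

Section Subpermanents.
Variables (k : fieldType) (n : nat).
Local Notation R := {mpoly k[#|{: symidx n}|]}.
Implicit Types (A B I J K M : {set 'I_n}) (p q i j : 'I_n) (u : R).

Lemma symvarC i j : symvar i j = symvar j i.
Proof.
congr (enum_rank _); apply/val_inj; rewrite /= /sort_pair.
by case: ltngtP => // /val_inj ->.
Qed.

Lemma symvar_eq i j p q :
  (symvar i j == symvar p q) = (i == p) && (j == q) || (i == q) && (j == p).
Proof.
apply/eqP/idP; last first.
  by case/orP=> /andP[/eqP-> /eqP->] //; rewrite symvarC.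
move/enum_rank_inj/(congr1 val); rewrite /= /sort_pair.
by case: ifP; case: ifP => _ _ [-> ->]; rewrite !eqxx ?orbT.
Qed.

(** The permanent of the submatrix with rows s and columns B, expanded along
    its first row: the recursion makes differentiation a matter of
    induction on s, and is 0 when s and B have different sizes. *)
Fixpoint rowperm (s : seq 'I_n) B : R :=
  if s is i :: s' then \sum_(j in B) 'X_(symvar i j) * rowperm s' (B :\ j)
  else (B == set0)%:R.

Definition subperm A B := rowperm (enum A) B.

Lemma subperm0 : subperm set0 set0 = 1.
Proof. by rewrite /subperm enum_set0 /= eqxx. Qed.

Lemma mderiv_var (v w : 'I_#|{: symidx n}|) : ('X_w : R)^`M(v) = (w == v)%:R.
Proof.
rewrite mderivX mnm1E; case: eqP => [->|_]; last by rewrite scale0r.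
by rewrite scale1r -[X in (X - _)%MM]add0m addmK mpolyX0.
Qed.

(** Every factor x_ij of a term of the expansion can be removed, which leaves
    the expansion without row i and column j. *)
Lemma mderiv_rowperm v (s : seq 'I_n) B : uniq s ->
  (rowperm s B)^`M(v) =
  \sum_(i <- s) \sum_(j in B | symvar i j == v) rowperm (rem i s) (B :\ j).
Proof.
elim: s B => [|a s IH] B /=.
  by rewrite big_nil; case: (B == set0); rewrite ?mderiv0 // mderivC.
case/andP=> a_s uniq_s; rewrite big_cons /= eqxx raddf_sum /=.
under eq_bigr => b _ do rewrite mderivM mderiv_var IH //.
rewrite big_split /=; congr (_ + _).
  rewrite big_mkcondr; apply: eq_bigr => b _.
  by case: eqP; rewrite ?mul1r ?mul0r.
under eq_bigr => b _ do rewrite mulr_sumr.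
rewrite exchange_big /= big_seq [RHS]big_seq; apply: eq_bigr => i i_s.
have -> : (a == i) = false by apply/eqP => a_i; rewrite a_i i_s in a_s.
under eq_bigr => b _ do rewrite mulr_sumr.
rewrite /= (exchange_big_dep (fun j => (j \in B) && (symvar i j == v))) /=.
  apply: eq_bigr => j /andP[jB /eqP vij]; rewrite vij eqxx.
  apply: eq_big => b; first by rewrite !inE jB !andbT eq_sym andbC.
  by rewrite !setDDl setUC.
by move=> b j bB /andP[]; rewrite !inE => /andP[_ ->] ->.
Qed.

Lemma mderiv_subperm v A B :
  (subperm A B)^`M(v) =
  \sum_(i in A) \sum_(j in B | symvar i j == v) subperm (A :\ i) (B :\ j).
Proof.
rewrite /subperm mderiv_rowperm ?enum_uniq // big_enum /=.
apply: eq_bigr => i _; apply: eq_bigr => j _; congr (rowperm _ _).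
rewrite rem_filter ?enum_uniq // /enum_mem -filter_predI.
by apply: eq_filter => x; rewrite /= !inE.
Qed.

Definition strike I J A B : R :=
  if (I \subset A) && (J \subset B) then subperm (A :\: I) (B :\: J) else 0.

Lemma sum_strike1 p q A B :
  \sum_(i in A) \sum_(j in B | (i == p) && (j == q)) subperm (A :\ i) (B :\ j)
  = strike [set p] [set q] A B.
Proof.
rewrite /strike !sub1set pair_big_dep /=; case: andP => [[pA qB]|npq].
  rewrite (big_pred1 (p, q)) // => -[i j] /=; rewrite xpair_eqE.
  by case: eqP => [->|_]; case: eqP => [->|_]; rewrite ?pA ?qB ?andbF.
rewrite big_pred0 // => -[i j] /=; apply/negP.
by case/and4P=> iA jB /eqP pi /eqP qj; case: npq; rewrite -pi -qj.
Qed.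

(** The derivative with respect to x_pq strikes row p and column q, but also
    row q and column p, since x_pq is the same variable as x_qp.  Hence only
    the sum of a choice (I, J) of rows and columns and of its transpose can be
    expected from a symbol u. *)
Definition strikes u I J :=
  forall A B, diffact u (subperm A B) = strike I J A B + strike J I A B.

Lemma diffact_loop p A B :
  diffact 'X_(symvar p p) (subperm A B) = strike [set p] [set p] A B.
Proof.
rewrite diffactX mderiv_subperm -sum_strike1; apply: eq_bigr => i _.
by apply: eq_bigl => j; rewrite symvar_eq orbb.
Qed.

Lemma strikes_edge p q : p != q -> strikes 'X_(symvar p q) [set p] [set q].
Proof.
move=> ne_pq A B; rewrite diffactX mderiv_subperm -!sum_strike1 -big_split /=.
apply: eq_bigr => i _; rewrite [LHS]big_mkcondr.
rewrite [X in X + _]big_mkcondr [X in _ + X]big_mkcondr -big_split /=.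
apply: eq_bigr => j _; rewrite symvar_eq.
have [->|_] := eqVneq i p; rewrite /= ?add0r //.
by rewrite (negPf ne_pq) /= orbF addr0.
Qed.

Lemma strikeU I J K M A B : [disjoint I & K] -> [disjoint J & M] ->
  (if (I \subset A) && (J \subset B) then strike K M (A :\: I) (B :\: J) else 0)
  = strike (I :|: K) (J :|: M) A B.
Proof.
rewrite (disjoint_sym I) (disjoint_sym J) => dIK dJM.
rewrite /strike !setDDl !subsetD !subUset dIK dJM !andbT.
by case: (I \subset A); case: (J \subset B); rewrite ?andbF.
Qed.

Lemma diffact_strike u I J K M A B : strikes u K M ->
    [disjoint I & K] -> [disjoint J & M] -> [disjoint I & M] -> [disjoint J & K] ->
  diffact u (strike I J A B)
  = strike (I :|: K) (J :|: M) A B + strike (I :|: M) (J :|: K) A B.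
Proof.
move=> uKM dIK dJM dIM dJK; rewrite -!strikeU // /strike.
by case: ifP => _; rewrite ?diffact0r ?addr0 // uKM.
Qed.

(** Multiplying by the variable y_pq distributes p and q over the two sides of
    the pair {K, M} in both possible ways. *)
Lemma diffact_edge p q u K M A B : p != q ->
    p \notin K :|: M -> q \notin K :|: M -> strikes u K M ->
  diffact ('X_(symvar p q) * u) (subperm A B)
  = strike (p |: K) (q |: M) A B + strike (p |: M) (q |: K) A B
    + (strike (q |: K) (p |: M) A B + strike (q |: M) (p |: K) A B).
Proof.
rewrite !inE !negb_or => ne_pq /andP[pK pM] /andP[qK qM] uKM.
rewrite mulrC diffactM (strikes_edge ne_pq) diffactDr.
by rewrite !(diffact_strike _ _ uKM) ?disjoints1.
Qed.

(** For a common element i of I and J the variable y_ii strikes row and column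
    i at once.  Otherwise let p be in I and q in J, and let u strike the rest of
    I and J: by [diffact_edge], y_pq u yields the sum of {I, J} and of the pair
    that results from the exchange of p and q.  Modulo operators already
    obtained, exchanging two elements across the pair is therefore a change of
    sign; but three exchanges p <-> q, q <-> r, r <-> p restore the pair, so
    twice each pair is obtained, and 2 is invertible. *)
Lemma exists_strikes (d : nat) I J : 2%:R != 0 :> k -> #|I| = d -> #|J| = d ->
  exists2 u : R, u \is d.-homog & strikes u I J.
Proof.
move=> nz2; elim: d I J => [|d IH] I J cI cJ.
  exists (2%:R *: 1); first by rewrite dhomogZ ?dhomog1.
  move=> A B; move/cards0_eq: cI => ->; move/cards0_eq: cJ => ->.
  by rewrite /strike !sub0set !setD0 diffactZl diffact1 scaler_nat mulr2n.
have [IJ0|[i]] := set_0Vmem (I :&: J); last first.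
  rewrite inE => /andP[iI iJ].
  have cI' : #|I :\ i| = d by move: cI; rewrite (cardsD1 i) iI => -[].
  have cJ' : #|J :\ i| = d by move: cJ; rewrite (cardsD1 i) iJ => -[].
  have [u hu uIJ] := IH _ _ cI' cJ'.
  exists ('X_(symvar i i) * u).
    by rewrite -add1n dhomogM // dhomogX; apply/eqP/mdeg1.
  move=> A B; rewrite mulrC diffactM diffact_loop (diffact_strike _ _ uIJ);
    rewrite ?disjoints1 ?inE ?eqxx //.
  by rewrite !setD1K.
have [p pI] : exists p, p \in I by apply/set0Pn; rewrite -card_gt0 cI.
have [q qJ] : exists q, q \in J by apply/set0Pn; rewrite -card_gt0 cJ.
have notIJ x : x \in I -> x \notin J.
  by move=> xI; have/setP/(_ x) := IJ0; rewrite !inE xI => /= ->.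
have pJ := notIJ _ pI; have qI : q \notin I by apply: contraL qJ; exact: notIJ.
have ne_pq : p != q by apply: contraNneq qI => <-.
have cE : #|I :\ p| = d by move: cI; rewrite (cardsD1 p) pI => -[].
have cJ' : #|J :\ q| = d by move: cJ; rewrite (cardsD1 q) qJ => -[].
case: d => [|d] in IH cI cJ cE cJ' *.
  have -> : I = [set p] by rewrite -(setD1K pI) (cards0_eq cE) setU0.
  have -> : J = [set q] by rewrite -(setD1K qJ) (cards0_eq cJ') setU0.
  exists 'X_(symvar p q); last exact: strikes_edge.
  by rewrite dhomogX; apply/eqP/mdeg1.
have [r] : exists r, r \in J :\ q by apply/set0Pn; rewrite -card_gt0 cJ'.
rewrite !inE => /andP[ne_rq rJ].
have rI : r \notin I by apply: contraL rJ; exact: notIJ.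
have ne_pr : p != r by apply: contraNneq rI => <-.
set E := I :\ p in cE *; set G := J :\ q :\ r.
have cG : #|G| = d by move: cJ'; rewrite (cardsD1 r) !inE ne_rq rJ => -[].
have [pE qE rE] : [/\ p \notin E, q \notin E & r \notin E].
  by rewrite !inE eqxx (negPf qI) (negPf rI) !andbF.
have [pG qG rG] : [/\ p \notin G, q \notin G & r \notin G].
  by rewrite !inE !eqxx (negPf pJ) !andbF.
have defI : I = p |: E by rewrite setD1K.
have defJ : J = q |: (r |: G) by rewrite !setD1K // !inE ne_rq.
clearbody E G; have cU x : x \notin G -> #|x |: G| = d.+1.
  by move=> xG; rewrite cardsU1 xG cG.
have [ur hr Hr] := IH _ _ cE (cU _ rG).
have [uq hq Hq] := IH _ _ cE (cU _ qG).
have [up hp Hp] := IH _ _ cE (cU _ pG).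
(* With E and G common to the three splittings, the symbols for the exchanges
   (p q) and (p r) both contain the pair (I, J); their other terms are those of
   the exchange (q r). *)
exists (2%:R^-1 *: ('X_(symvar p q) * ur + 'X_(symvar p r) * uq
                    - 'X_(symvar q r) * up)).
  have hX x y : ('X_(symvar x y) : R) \is 1.-homog.
    by rewrite dhomogX; apply/eqP/mdeg1.
  by rewrite dhomogZ // rpredB ?rpredD // -[d.+2]add1n dhomogM.
move=> A B; rewrite diffactZl -scaleN1r !diffactDl diffactZl scaleN1r.
have out x y : x \notin E -> x \notin G -> x != y ->
    x \notin E :|: (y |: G).
  by move=> xE xG ne_xy; rewrite !inE !negb_or xE xG ne_xy.
rewrite (diffact_edge _ _ ne_pq _ _ Hr) ?out // 1?eq_sym //.
rewrite (diffact_edge _ _ ne_pr _ _ Hq) ?out // 1?eq_sym //.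
have ne_qr : q != r by rewrite eq_sym.
rewrite (diffact_edge _ _ ne_qr _ _ Hp) ?out // 1?eq_sym //.
rewrite -defI (setUCA [set r] [set q] G) -defJ.
rewrite (setUCA [set q] [set p] G) (setUCA [set r] [set p] G).
apply: (scalerI nz2); rewrite scalerA divff // scale1r scaler_nat mulr2n.
ring.
Qed.

End Subpermanents.

(** * The apolar ideal of the permanent *)

Section Permanent.
Variables (k : fieldType) (n : nat).
Local Notation R := {mpoly k[#|{: symidx n}|]}.
Implicit Types (A B I J : {set 'I_n}) (p q i j : 'I_n) (u : R).
Local Notation F := (permanent (generic_sym_mx k n)).

(** The permutations with prescribed values t on the rows s1 sum up to the
    permanent of the remaining rows and columns.  For empty s1 this identifies
    the row expansion with the sum over all permutations; the induction removes
    rows from s2, so it starts from completely prescribed permutations. *)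
Lemma sum_perm_prefix (s1 s2 t : seq 'I_n) : s1 ++ s2 = enum 'I_n ->
    uniq t -> size t = size s1 ->
  \sum_(s : 'S_n | map s s1 == t) \prod_(i <- s2) 'X_(symvar i (s i))
  = rowperm k s2 (~: [set x in t]).
Proof.
elim: s2 s1 t => [|a s2 IH] s1 t defs uniq_t size_t.
  rewrite cats0 in defs; rewrite {s1}defs size_enum_ord in size_t *.
  have /tuple_uniqP t_inj : uniq (Tuple (introT eqP size_t)) by [].
  rewrite (big_pred1 (perm t_inj)) => [|s] /=.
    rewrite big_nil; apply/esym; rewrite [_ == _](_ : _ = true) //.
    apply/eqP/setP => x; rewrite !inE; apply/negbF.
    have sub_t : {subset t <= enum 'I_n} by move=> y _; rewrite mem_enum.
    have [|_ ->] := uniq_min_size uniq_t sub_t; last by rewrite mem_enum.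
    by rewrite size_enum_ord size_t.
  have def_t : t = map (perm t_inj) (enum 'I_n).
    rewrite -[t in LHS]/(tval (Tuple (introT eqP size_t))) -[LHS]map_tnth_enum.
    by apply: eq_map => i; rewrite permE.
  rewrite {1}def_t; apply/eqP/eqP => [eq_s|-> //]; apply/permP => i.
  by have /eq_in_map := eq_s; apply; rewrite mem_enum.
rewrite (partition_big (fun s : 'S_n => s a) predT) //= big_mkcond [RHS]big_mkcond /=.
have uniq_s1 : uniq (s1 ++ a :: s2) by rewrite defs enum_uniq.
apply: eq_bigr => b _; rewrite !inE; have [bt|bt] /= := boolP (b \in t).
  rewrite big_pred0 // => s; apply/negP => /andP[/eqP deft /eqP sab].
  move: bt; rewrite -deft -sab (mem_map perm_inj) => as1.
  by move: uniq_s1; rewrite cat_uniq /= as1 !andbF.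
have -> : ~: [set x in t] :\ b = ~: [set x in rcons t b].
  by apply/setP => x; rewrite !inE mem_rcons inE negb_or.
rewrite -(IH (rcons s1 a)) ?cat_rcons ?rcons_uniq ?bt ?size_rcons ?size_t //.
rewrite mulr_sumr; apply: eq_big => [s|s /andP[_ /eqP sab]].
  by rewrite map_rcons eqseq_rcons.
by rewrite big_cons sab.
Qed.

Lemma permanent_subperm : F = subperm k setT setT.
Proof.
rewrite /permanent /subperm enum_setT.
have := @sum_perm_prefix [::] (enum 'I_n) [::] erefl erefl erefl.
rewrite (_ : ~: [set x in [::]] = setT); last by apply/setP => x; rewrite !inE.
rewrite [X in rowperm _ X](_ : _ = Finite.enum _) ?enumT // => <-.
apply: eq_bigr => s _; rewrite -enumT big_enum /=.
by apply: eq_bigr => i _; rewrite mxE.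
Qed.

Lemma permanent_homog : F \is n.-homog.
Proof.
apply: rpred_sum => s _; set m := \prod_(i < n) _.
suff: m \is (\sum_(i < n) 1).-homog by rewrite sum1_card card_ord.
rewrite /m; elim/big_rec2: _ => [|i d m' _ hm]; first exact: dhomog1.
by apply: dhomogM => //; rewrite mxE dhomogX; apply/eqP/mdeg1.
Qed.

(** A row index occurs twice in the symmetric matrix, once as a row and once
    as a column, so no variable can be struck three times. *)
Lemma Ann_permanent_cube v : Ann F ('X_v ^+ 3).
Proof.
rewrite /Ann permanent_subperm.
have [[[p q] /= le_pq] def_v] : exists x : symidx n, v = enum_rank x.
  by exists (enum_val v); rewrite enum_valK.
have {def_v} -> : v = symvar p q.
  rewrite def_v; congr enum_rank; apply/val_inj => /=.
  by rewrite /sort_pair le_pq.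
have D A B : diffact 'X_(symvar p q) (subperm k A B) = \sum_(i in A)
    \sum_(j in B | symvar i j == symvar p q) subperm k (A :\ i) (B :\ j).
  by rewrite diffactX mderiv_subperm.
rewrite exprSr diffactM D diffact_sumr.
apply: big1 => i _; rewrite diffact_sumr big1 // => j /andP[_ vij].
rewrite expr2 diffactM D diffact_sumr big1 // => i' iA'.
rewrite diffact_sumr big1 // => j' /andP[_ vij'].
rewrite D big1 // => i'' iA''; rewrite big1 // => j'' /andP[_ vij''].
move: vij vij' vij'' iA' iA''; rewrite !symvar_eq !inE.
by do 3![case/orP=> /andP[/eqP-> _]]; rewrite ?eqxx ?andbF.
Qed.

(** Unordered pairs of sets of the same size, represented by the ordered pairs
    that increase for an arbitrary total order on sets. *)
Definition upair (t : {set 'I_n} * {set 'I_n}) : bool :=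
  (#|t.1| == #|t.2|) && (enum_rank t.1 <= enum_rank t.2)%N.

Lemma strike_compl I J I' J' : #|I'| = #|I| -> #|J'| = #|J| ->
  strike k (~: I') (~: J') (~: I) (~: J) = ((I == I') && (J == J'))%:R.
Proof.
move=> cI cJ; rewrite /strike !setCS ![_ \subset _]subEproper.
rewrite !properEcard cI cJ !ltnn !andbF !orbF.
case: eqP => [->|_] //=; case: eqP => [->|_] //=.
by rewrite !setDv subperm0.
Qed.

(** Let u (I, J) be a symbol that strikes I and J.  It sends the permanent to
    a sum of two complementary subpermanents, and a symbol that strikes the
    complements of I' and J' sends these to 0 unless the unordered pairs
    {I, J} and {I', J'}, of sets of the same size, agree.  This pairing is thus diagonal, with entries 2
    and 4 (the latter for I = J), and the u (I, J) of a given degree are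
    independent modulo the apolar ideal. *)
Lemma catalecticant_independent : 2%:R != 0 :> k ->
  exists u : {set 'I_n} * {set 'I_n} -> R,
    (forall t : {set 'I_n} * {set 'I_n}, #|t.1| = #|t.2| -> u t \is #|t.1|.-homog) /\
    (forall d (c : {set 'I_n} * {set 'I_n} -> k),
       Ann F (\sum_(t : {set 'I_n} * {set 'I_n} | upair t && (#|t.1| == d)) c t *: u t) ->
       forall t : {set 'I_n} * {set 'I_n}, upair t -> #|t.1| = d -> c t = 0).
Proof.
move=> nz2.
have /fin_all_exists[u Hu] (t : {set 'I_n} * {set 'I_n}) : exists u : R,
    #|t.1| = #|t.2| -> u \is #|t.1|.-homog /\ strikes u t.1 t.2.
  have [e|ne] := eqVneq #|t.1| #|t.2|; last by exists 0 => /eqP; rewrite (negPf ne).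
  have [u hu su] := exists_strikes nz2 erefl (esym e).
  by exists u.
exists u; split=> [t /Hu[] //|d c Fc [I J]] uIJ /= cI.
have /andP[/eqP /= cIJ rIJ] := uIJ.
have [|v hv sv] := exists_strikes nz2 erefl (_ : #|~: J| = #|~: I|).
  by apply/eqP; rewrite -(eqn_add2l #|J|) cardsC -cIJ cardsC.
have /(congr1 (diffact v)) := Fc; rewrite diffact0r diffact_suml diffact_sumr.
have vu (t : {set 'I_n} * {set 'I_n}) : upair t && (#|t.1| == d) ->
    diffact v (diffact (c t *: u t) F) = (c t * 2%:R * ((t == (I, J)) + (t == (J, I)))%:R)%:MP.
  case: t => I' J' /andP[/andP[/eqP/= cIJ' _] /eqP cd].
  have [_ /= su] := Hu (I', J') cIJ'.
  have strikeT K M : strike k K M setT setT = subperm k (~: K) (~: M).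
    by rewrite /strike !subsetT !setTD.
  have [cI' cJ'] : #|I| = #|I'| /\ #|J| = #|J'| by rewrite -cIJ' -cIJ cI cd.
  have [cIJ'' cJI'] : #|I| = #|J'| /\ #|J| = #|I'| by rewrite -cIJ' -cIJ cI cd.
  rewrite diffactZl diffactZr permanent_subperm su diffactDr !strikeT !sv.
  rewrite !strike_compl // !xpair_eqE (andbC (J' == I)) (andbC (J' == J)).
  rewrite -mulrA mpolyCM mul_mpolyC -natrM mpolyC_nat -!natrD mul2n -addnn.
  by rewrite [X in (_ + X)%:R]addnC.
rewrite (bigD1 (I, J)) ?uIJ ?cI ?eqxx //= big1 ?addr0 => [|t /andP[ut net]].
  move/(congr1 (mcoeff 0)); rewrite vu ?uIJ ?cI ?eqxx // mcoeffC eqxx mcoeff0 mulr1.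
  move/eqP; rewrite !mulf_eq0 (negPf nz2) orbF => /orP[/eqP //|].
  by rewrite xpair_eqE (eq_sym J) andbb; case: (I == J); rewrite /= ?(negPf nz2) ?oner_eq0.
rewrite vu // (negPf net) add0n; have [def_t|_] := eqVneq t (J, I); last first.
  by rewrite mulr0 mpolyC0.
case/negP: net; move: ut; rewrite def_t => /andP[/andP[_ /= rJI] _].
suff -> : I = J by [].
by apply: enum_rank_inj; apply/val_inj/anti_leq; rewrite /= rIJ rJI.
Qed.

End Permanent.

(** * Regular elements modulo a saturated ideal *)

Section InfiniteField.
Variable k : fieldType.
Hypothesis k_infinite : forall t : seq k, exists x : k, x \notin t.

Lemma infinite_uniq_seq m : exists2 s : seq k, uniq s & size s = m.
Proof.
elim: m => [|m [s us <-]]; first by exists [::].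
by have [x xs] := k_infinite s; exists (x :: s); rewrite //= xs.
Qed.

Lemma infinite_nonroot (p : {poly k}) : p != 0 -> exists t, p.[t] != 0.
Proof.
move=> nz_p; have [s us size_s] := infinite_uniq_seq (size p).
have [/(max_poly_roots nz_p)/(_ us)|/allPn[t _ pt]] := boolP (all (root p) s).
  by rewrite size_s ltnn.
by exists t.
Qed.

End InfiniteField.

Section Ideals.
Variables (A : comNzRingType) (N : nat) (I : {mpoly A[N]} -> Prop).
Hypothesis idI : is_ideal I.
Implicit Types g h x : {mpoly A[N]}.

Lemma ideal0 : I 0. Proof. by case: idI. Qed.
Lemma idealD g h : I g -> I h -> I (g + h). Proof. by case: idI => _ + _; apply. Qed.
Lemma idealMl g h : I h -> I (g * h). Proof. by case: idI => _ _; apply. Qed.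
Lemma idealZ c h : I h -> I (c *: h).
Proof. by rewrite -mul_mpolyC; apply: idealMl. Qed.
Lemma idealN h : I h -> I (- h).
Proof. by rewrite -scaleN1r; apply: idealZ. Qed.
Lemma idealB g h : I g -> I h -> I (g - h).
Proof. by move=> Ig Ih; apply: idealD => //; apply: idealN. Qed.
Lemma ideal_sum (T : Type) (r : seq T) (P : pred T) (u : T -> {mpoly A[N]}) :
  (forall i, P i -> I (u i)) -> I (\sum_(i <- r | P i) u i).
Proof. by move=> Iu; elim/big_ind: _ => //; [exact: ideal0|exact: idealD]. Qed.
Lemma idealBl g h : I (g - h) -> I g -> I h.
Proof. by move=> Igh Ig; rewrite -(subKr g h); apply: idealB. Qed.

Lemma idealDl g h : I (g + h) -> I h -> I g.
Proof. by move=> Igh Ih; rewrite -(addrK h g); apply: idealB. Qed.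

(** The extension of I to polynomials in one more variable. *)
Definition poly_ideal (h : {poly {mpoly A[N]}}) := forall i, I h`_i.

Lemma poly_idealD (g h : {poly {mpoly A[N]}}) : poly_ideal g -> poly_ideal h -> poly_ideal (g + h).
Proof. by move=> Jg Jh i; rewrite coefD; apply: idealD. Qed.

Lemma poly_idealMl (g h : {poly {mpoly A[N]}}) : poly_ideal h -> poly_ideal (g * h).
Proof. by move=> Jh i; rewrite coefM; apply: ideal_sum => j _; apply: idealMl. Qed.

Lemma poly_idealN (h : {poly {mpoly A[N]}}) : poly_ideal h -> poly_ideal (- h).
Proof. by move=> Jh i; rewrite coefN; apply: idealN. Qed.

Lemma poly_idealC x : I x -> poly_ideal x%:P.
Proof. by move=> Ix i; rewrite coefC; case: ifP => // _; exact: ideal0. Qed.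

Lemma poly_ideal_sum (T : Type) (r : seq T) (P : pred T) u :
  (forall i : T, P i -> poly_ideal (u i)) -> poly_ideal (\sum_(i <- r | P i) u i).
Proof. by move=> Ju j; rewrite coef_sum; apply: ideal_sum => i /Ju. Qed.

(** McCoy's theorem modulo I: a polynomial is regular as soon as its
    coefficients have no common annihilator.  Let w be the degree of h.  If the
    products p`_a * h with a > i vanish modulo I, then the coefficient of p * h in degree i + w
    reduces to p`_i times the leading coefficient of h, so that p`_i * h has a
    lower degree than h and is killed by p: it vanishes by induction. *)
Lemma mccoy (p h : {poly {mpoly A[N]}}) :
  (forall x, (forall j, I (p`_j * x)) -> I x) ->
  poly_ideal (p * h) -> poly_ideal h.
Proof.
move=> regp; elim: {h}(size h) {-2}h (leqnn (size h)) => [|w IH] h.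
  by rewrite leqn0 size_poly_eq0 => /eqP -> _ i; rewrite coef0; exact: ideal0.
move=> size_h Jph.
have coef_h_gt a : (w < a)%N -> h`_a = 0 by move=> wa; apply/leq_sizeP/(leq_trans size_h).
(* Descending induction on i, in terms of the distance m to the size of p. *)
have Jpih m : forall i, (size p - m <= i)%N -> poly_ideal ((p`_i)%:P * h).
  elim: m => [|m IHm] i le_i.
    rewrite subn0 in le_i; have /leq_sizeP/(_ i (leqnn i)) -> := le_i.
    by rewrite mul0r => j; rewrite coef0; exact: ideal0.
  have Ipx : I (p`_i * h`_w).
    have := Jph (i + w)%N; rewrite coefM.
    rewrite (bigD1 (inord i)) //= inordK ?ltnS ?leq_addr // addKn => Ih.
    apply: idealDl Ih _; apply: ideal_sum => a /negP ne_ai.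
    have [lt_ai|le_ia] := ltnP a i.
      by rewrite coef_h_gt ?mulr0 ?ltn_subRL 1?ltn_add2r //; exact: ideal0.
    rewrite -coefCM; apply: IHm; rewrite leq_subLR.
    move: le_i; rewrite leq_subLR addSnnS => /leq_trans; apply.
    rewrite leq_add2l ltn_neqAle le_ia andbT.
    by apply/negP => /eqP e; apply: ne_ai; apply/eqP/val_inj; rewrite /= inordK ?ltnS ?leq_addr.
  set x := h`_w; set h' := h - x%:P * 'X^w.
  have size_h' : (size ((p`_i)%:P * h')%R <= w)%N.
    apply/leq_sizeP => j; rewrite leq_eqVlt coefCM coefB coefCM coefXn.
    case/orP => [/eqP <-|lt_wj]; first by rewrite eqxx mulr1 subrr mulr0.
    by rewrite coef_h_gt // (gtn_eqF lt_wj) mulr0 subrr mulr0.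
  have JpxX : poly_ideal ((p`_i)%:P * (x%:P * 'X^w)).
    rewrite mulrA -polyCM mulrC; apply: poly_idealMl; exact: poly_idealC.
  have : poly_ideal ((p`_i)%:P * h').
    apply: IH size_h' _; rewrite mulrCA mulrBr mulrBr.
    apply: poly_idealD; first exact: poly_idealMl.
    by apply: poly_idealN; rewrite mulrCA; exact: poly_idealMl.
  by move=> Jph'; rewrite -(subrK (x%:P * 'X^w) h) mulrDr; apply: poly_idealD.
move=> j; apply: regp => i; rewrite -coefCM; apply: (Jpih (size p)).
by rewrite subnn.
Qed.

End Ideals.

Section QuotientBasis.
Variables (k : fieldType) (N : nat) (I : {mpoly k[N]} -> Prop).
Hypothesis idI : is_ideal I.

Lemma quot_basis d s : quot_free_rank I d s ->
  exists b : 'I_s -> {mpoly k[N]},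
  [/\ forall i, b i \is d.-homog,
      forall h, h \is d.-homog -> exists c : 'rV[k]_s, I (h - \sum_i c 0 i *: b i)
    & forall c : 'rV[k]_s, I (\sum_i c 0 i *: b i) -> c = 0].
Proof.
case=> b [hb Hb]; exists b; split=> // [h /Hb[c [Ic _]]|c Ic].
  by exists (\row_i c i); under eq_bigr => i _ do rewrite mxE.
have [c0 [_ uniq_c]] := Hb 0 (dhomog0 _ _ _).
have eq_c : c0 = [ffun i => c 0 i].
  by apply: uniq_c; rewrite sub0r; apply: idealN => //; under eq_bigr => i _ do rewrite ffunE.
have eq_0 : c0 = [ffun=> 0].
  apply: uniq_c; rewrite sub0r big1 ?oppr0; first exact: ideal0.
  by move=> i _; rewrite ffunE scale0r.
by apply/rowP => i; move: eq_c; rewrite eq_0 => /ffunP/(_ i); rewrite !ffunE mxE => <-.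
Qed.

Lemma independent_leq_rank d s (T : finType) (P : pred T) (w : T -> {mpoly k[N]}) :
    quot_free_rank I d s -> (forall t, P t -> w t \is d.-homog) ->
    (forall c : T -> k, I (\sum_(t | P t) c t *: w t) -> forall t, P t -> c t = 0) ->
  (#|P| <= s)%N.
Proof.
case/quot_basis=> b [hb Hb _] hw indep.
have /fin_all_exists[C HC] (i : 'I_#|P|) :
    exists c : 'rV[k]_s, I (w (enum_val i) - \sum_j c 0 j *: b j).
  by apply/Hb/hw; exact: (enum_valP i).
pose M := \matrix_(i < #|P|) C i.
suff free_M : row_free M by rewrite -(eqP free_M) rank_leq_col.
apply: inj_row_free => v vM0; apply/rowP => i; rewrite mxE.
pose c t := if [pick j | enum_val j == t] is Some j then v 0 j else 0.
have cE j : c (enum_val j) = v 0 j.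
  rewrite /c; case: pickP => [j' /eqP/enum_val_inj -> //|/(_ j)].
  by rewrite eqxx.
rewrite -cE; apply: indep; last exact: (enum_valP i).
rewrite (big_enum_val (A := P)) /=.
have v0 : \sum_j (v *m M) 0 j *: b j = 0 by rewrite vM0 big1 // => j _; rewrite mxE scale0r.
rewrite -[X in I X]subr0 -[X in _ - X]v0.
rewrite (_ : _ - _ = \sum_i v 0 i *: (w (enum_val i) - \sum_j C i 0 j *: b j)).
  by apply: ideal_sum => // j _; apply: idealZ.
under [RHS]eq_bigr => j _ do rewrite scalerBr.
rewrite sumrB; congr (_ - _); first by apply: eq_bigr => j _; rewrite cE.
under [RHS]eq_bigr => j _ do rewrite scaler_sumr.
rewrite [RHS]exchange_big /=; apply: eq_bigr => j _; rewrite mxE scaler_suml.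
by apply: eq_bigr => j' _; rewrite mxE scalerA.
Qed.

End QuotientBasis.

Section RegularCubic.
Variables (k : fieldType) (N : nat) (I : {mpoly k[N]} -> Prop).
Hypothesis k_infinite : forall t : seq k, exists x : k, x \notin t.
Hypotheses (idI : is_ideal I) (satI : saturated I).
Implicit Types h x : {mpoly k[N]}.

(** By the pigeonhole principle a monomial of degree greater than 2 N is
    divisible by a cube, so the cubes of the variables have no common zero. *)
Lemma cubes_regular x : (forall j : 'I_N, I ('X_j ^+ 3 * x)) -> I x.
Proof.
move=> Ix; apply: satI; exists (2 * N).+1 => g /dhomogP hg.
rewrite (mpolyE g) mulr_suml big_seq; apply: ideal_sum => // m /hg /= deg_m.
have [j m3] : exists j, (2 < m j)%N.
  apply/existsP; apply: contraPT deg_m => /existsPn m2; apply/eqP.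
  rewrite ltn_eqF // ltnS mdegE mulnC -[N in (N * _)%N]card_ord -sum_nat_const.
  by apply: leq_sum => j _; rewrite leqNgt m2.
rewrite -scalerAl; apply: idealZ => //.
have -> : m = ((m - U_(j) *+ 3) + U_(j) *+ 3)%MM.
  rewrite submK //; apply/mnm_lepP => i; rewrite mulmnE mnm1E.
  by case: eqP => [<-|].
by rewrite mpolyXD -mulrA -mpolyXn; apply: idealMl.
Qed.

Definition cubic (a : 'I_N -> k) := \sum_j a j *: 'X_j ^+ 3 : {mpoly k[N]}.

(** A generic combination of the cubes of the variables is regular modulo I
    in degree D: multiplication by the generic member of the pencil
    y_1^3 + t y_2^3 + t^2 y_3^3 + ... from degree D to degree D + 3 has a
    determinant in k[t], which is nonzero by McCoy's theorem. *)
Lemma exists_regular_cubic D s :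
    quot_free_rank I D s -> quot_free_rank I (D + 3) s ->
  exists a : 'I_N -> k,
    forall h, h \is D.-homog -> I (cubic a * h) -> I h.
Proof.
case/quot_basis => // b [hb spanb freeb].
case/quot_basis => // b' [hb' spanb' freeb'].
have hX3 (j : 'I_N) : ('X_j ^+ 3 : {mpoly k[N]}) \is 3.-homog.
  by apply: (dhomogMn 3 (_ : 'X_j \is 1.-homog)); rewrite dhomogX; apply/eqP/mdeg1.
have /fin_all_exists[C HC] (ji : 'I_N * 'I_s) : exists c : 'rV[k]_s,
    I ('X_ji.1 ^+ 3 * b ji.2 - \sum_l c 0 l *: b' l).
  by apply: spanb'; rewrite addnC dhomogM.
(* Multiplication by the generic member of the pencil, in the bases b and b'. *)
pose M := \matrix_(i < s, l < s) \sum_(j < N) (C (j, i) 0 l)%:P * 'X^j.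
(* A kernel vector v over k[t] would give a polynomial h in t whose product
   with the generic cubic p vanishes modulo I. *)
have nz_detM : \det M != 0.
  apply/det0P => -[v nz_v vM0]; case/negP: nz_v; apply/eqP/rowP => i.
  rewrite mxE; apply/polyP => m; rewrite coef0.
  pose lft := map_poly (@mpolyC N k).
  pose p : {poly {mpoly k[N]}} := \sum_(j < N) ('X_j ^+ 3)%:P * 'X^j.
  pose h : {poly {mpoly k[N]}} := \sum_i lft (v 0 i) * (b i)%:P.
  have coef_p (j : 'I_N) : p`_j = 'X_j ^+ 3.
    rewrite coef_sum (bigD1 j) //= coefCM coefXn eqxx mulr1 big1 ?addr0 //.
    by move=> j' ne; rewrite coefCM coefXn eq_sym (inj_eq val_inj) (negPf ne) mulr0.
  have : poly_ideal I h.
    apply: (@mccoy _ _ _ idI p) => [x Ix|].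
      by apply: cubes_regular => j; rewrite -coef_p.
    rewrite /p /h mulr_suml.
    have vM : \sum_l lft ((v *m M) 0 l) * (b' l)%:P = 0.
      by rewrite vM0 big1 // => l _; rewrite mxE /lft rmorph0 mul0r.
    rewrite -[X in poly_ideal _ X]subr0 -[X in _ - X]vM.
    rewrite (_ : _ - _ = \sum_(j < N) \sum_(i < s) lft (v 0 i) * 'X^j *
       ('X_j ^+ 3 * b i - \sum_l C (j, i) 0 l *: b' l)%:P).
      apply: poly_ideal_sum => // j _; apply: poly_ideal_sum => // i' _.
      by apply: poly_idealMl => //; apply: poly_idealC => //; exact: (HC (j, i')).
    have termE (j : 'I_N) i' x : lft (v 0 i') * 'X^j * ('X_j ^+ 3 * b i' - x)%:P
        = ('X_j ^+ 3)%:P * 'X^j * (lft (v 0 i') * (b i')%:P)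
          - lft (v 0 i') * 'X^j * x%:P.
      by rewrite polyCB polyCM; ring.
    under [RHS]eq_bigr => j _ do under eq_bigr => i' _ do rewrite termE.
    under [RHS]eq_bigr => j _ do rewrite sumrB.
    rewrite sumrB; congr (_ - _).
      by apply: eq_bigr => j _; rewrite mulr_sumr.
    have lhsE l : lft ((v *m M) 0 l) * (b' l)%:P = \sum_(j < N) \sum_(i < s)
        lft (v 0 i) * 'X^j * (C (j, i) 0 l *: b' l)%:P.
      rewrite mxE /lft rmorph_sum mulr_suml exchange_big /=; apply: eq_bigr => i' _.
      rewrite mxE mulr_sumr rmorph_sum mulr_suml; apply: eq_bigr => j _.
      rewrite !rmorphM /= map_polyXn map_polyC -mul_mpolyC polyCM /=.
      ring.
    apply: etrans (eq_bigr _ (fun l _ => lhsE l)) _.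
    rewrite exchange_big; apply: eq_bigr => j _ /=.
    rewrite exchange_big; apply: eq_bigr => i' _ /=.
    by rewrite rmorph_sum mulr_sumr.
  move=> /(_ m); rewrite coef_sum.
  have -> : \sum_i0 (lft (v 0 i0) * (b i0)%:P)`_m
          = \sum_l (\row_i (v 0 i)`_m) 0 l *: b l.
    apply: eq_bigr => l _; rewrite coefMC mxE coef_map_id0 ?rmorph0 //.
    exact: mul_mpolyC.
  by move/freeb/rowP/(_ i); rewrite !mxE.
have [t nz_t] := infinite_nonroot k_infinite nz_detM.
exists (fun j => t ^+ j) => h hh Igh.
have [c Ic] := spanb h hh.
suff c0 : c = 0.
  by move: Ic; rewrite c0 big1 ?subr0 // => i _; rewrite mxE scale0r.
have unitM : map_mx (horner_eval t) M \in unitmx.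
  by rewrite unitmxE det_map_mx unitfE.
apply: (row_free_inj (A := map_mx (horner_eval t) M)).
  by rewrite row_free_unit.
rewrite mul0mx; apply: freeb'.
have Icgb : I (\sum_i c 0 i *: (cubic (fun j => t ^+ j) * b i)).
  have := idealB idI Igh (idealMl idI (cubic (fun j => t ^+ j)) Ic).
  rewrite -mulrBr subKr mulr_sumr.
  by under eq_bigr => i _ do rewrite -scalerAr.
apply: (idealBl idI _ Icgb).
rewrite (_ : _ - _ = \sum_i \sum_(j < N) (c 0 i * t ^+ j) *:
    ('X_j ^+ 3 * b i - \sum_l C (j, i) 0 l *: b' l)).
  apply: ideal_sum => // i _; apply: ideal_sum => // j _.
  by apply: idealZ => //; exact: (HC (j, i)).
under [RHS]eq_bigr => i _ do under eq_bigr => j _ do rewrite scalerBr.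
under [RHS]eq_bigr => i _ do rewrite sumrB.
rewrite sumrB; congr (_ - _).
  apply: eq_bigr => i _; rewrite mulr_suml scaler_sumr; apply: eq_bigr => j _.
  by rewrite -scalerAl scalerA.
under [RHS]eq_bigr => i _ do under eq_bigr => j _ do rewrite scaler_sumr.
under [RHS]eq_bigr => i _ do rewrite exchange_big.
rewrite [RHS]exchange_big; apply: eq_bigr => l _ /=.
rewrite mxE scaler_suml; apply: eq_bigr => i _.
rewrite !mxE horner_evalE horner_sum mulr_sumr scaler_suml; apply: eq_bigr => j _.
by rewrite hornerM hornerC hornerXn scalerA mulrAC -mulrA.
Qed.

(** A form h of degree less than D can be multiplied by all forms of the
    missing degree, and saturation recovers h from these products. *)
Lemma regular_lower (g : {mpoly k[N]}) D d :
    (forall h, h \is D.-homog -> I (g * h) -> I h) -> (d <= D)%N ->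
  forall h, h \is d.-homog -> I (g * h) -> I h.
Proof.
move=> reg_g le_dD h hh Igh; apply: satI; exists (D - d)%N => w hw.
apply: reg_g; first by rewrite -(subnK le_dD) dhomogM.
by rewrite mulrCA; apply: idealMl.
Qed.

Lemma regular_exp (g : {mpoly k[N]}) D d m : g \is 3.-homog ->
    (forall h, h \is D.-homog -> I (g * h) -> I h) -> (d + 3 * m <= D + 3)%N ->
  forall h, h \is d.-homog -> I (g ^+ m * h) -> I h.
Proof.
move=> hg reg_g; elim: m => [|m IH] le_D h hh; first by rewrite mul1r.
rewrite exprS -mulrA => Igmh; apply: (IH _ h hh).
  by apply: leq_trans le_D; rewrite leq_add2l leq_mul2l leqnSn.
apply: (@regular_lower g D (3 * m + d)) Igmh => //.
  by rewrite -(leq_add2r 3) addnAC -mulnSr addnC.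
exact: dhomogM (dhomogMn m hg) hh.
Qed.

Lemma cubic_homog (a : 'I_N -> k) : cubic a \is 3.-homog.
Proof.
apply: rpred_sum => j _; apply: dhomogZ.
by apply: (dhomogMn 3 (_ : 'X_j \is 1.-homog)); rewrite dhomogX; apply/eqP/mdeg1.
Qed.

End RegularCubic.

(** * The lower bound for the length of an apolar scheme *)

Section LowerBound.
Variables (k : fieldType) (n : nat).
Hypothesis k_infinite : forall t : seq k, exists x : k, x \notin t.
Hypothesis nz2 : 2%:R != 0 :> k.
Local Notation N := #|{: symidx n}|.
Local Notation F := (permanent (generic_sym_mx k n)).
Local Notation upairs := [pred t : {set 'I_n} * {set 'I_n} | upair t].
Variable I : {mpoly k[N]} -> Prop.
Hypotheses (idI : is_ideal I) (satI : saturated I).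

Lemma Ann_permanent_cubic (a : 'I_N -> k) : Ann F (cubic a).
Proof.
rewrite /Ann diffact_suml big1 // => j _.
by rewrite diffactZl Ann_permanent_cube scaler0.
Qed.

(** The degree of the artinian quotient by I and a regular cubic g is at most
    three times the length of the scheme; here the argument is carried out
    within three graded pieces of large degree, one for each residue class
    modulo 3.  A symbol u t of degree 3 q + r is moved to degree 3 D + r by the
    power g ^ (D - q).  A relation between these elements modulo I can be
    divided by the lowest power of g that occurs; since I and g are apolar to
    the permanent, the terms with this lowest power then form a relation
    modulo the apolar ideal, which is trivial. *)
Lemma upair_leq_length (s : nat) (d0 : nat) :
    (forall d, (d0 <= d)%N -> quot_free_rank I d s) ->
    (forall h, I h -> Ann F h) ->
  (#|upairs| <= 3 * s)%N.
Proof.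
move=> Hs apolarI; have [u [hu indep_u]] := catalecticant_independent n nz2.
pose D := maxn d0 n.
have le_dD : (d0 <= 3 * D)%N by apply: leq_trans (leq_maxl d0 n) (leq_pmull _ _).
have [a reg_a] := exists_regular_cubic k_infinite idI satI (Hs _ le_dD)
  (Hs _ (leq_trans le_dD (leq_addr 3 _))).
set g := cubic a in reg_a; have hg : g \is 3.-homog := cubic_homog a.
pose q (t : {set 'I_n} * {set 'I_n}) := (#|t.1| %/ 3)%N.
have le_qD t : (q t <= D)%N.
  apply: leq_trans (leq_div _ _) (leq_trans (max_card _) _).
  by rewrite card_ord leq_maxr.
pose P (r : nat) := [pred t : {set 'I_n} * {set 'I_n} | upair t && (#|t.1| %% 3 == r)%N].
pose e t := (D - q t)%N.
suff le_P r : (r < 3)%N -> (#|P r| <= s)%N.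
  pose res (t : {set 'I_n} * {set 'I_n}) : 'I_3 := inord (#|t.1| %% 3).
  rewrite -sum1_card (partition_big res predT) //=.
  have -> : (3 * s = \sum_(r < 3) s)%N by rewrite sum_nat_const card_ord.
  apply: leq_sum => r _.
  rewrite sum1_card; apply: leq_trans (le_P r (ltn_ord r)).
  apply/eq_leq/eq_card => t; rewrite !inE; congr (_ && _).
  by rewrite -(inj_eq val_inj) /= inordK // ltn_mod.
move=> lt_r3.
have deg_u t : P r t -> u t \is (3 * q t + r).-homog.
  by case/andP=> /andP[/eqP ct _] /eqP <-; rewrite mulnC -divn_eq; apply: hu.
pose w t := g ^+ e t * u t.
apply: (@independent_leq_rank _ _ _ idI (3 * D + r) s _ (P r) w).
- by apply: Hs; apply: leq_trans le_dD (leq_addr _ _).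
- move=> t Pt; rewrite (_ : 3 * D + r = 3 * e t + (3 * q t + r))%N.
    exact: dhomogM (dhomogMn _ hg) (deg_u _ Pt).
  by rewrite addnA -mulnDr subnK.
move=> c Iw; suff c0 m t : P r t -> (e t < m)%N -> c t = 0.
  by move=> t Pt; apply: (c0 D.+1 t Pt); rewrite ltnS leq_subr.
(* Induction on the exponent e t of g: the coefficients with e < m vanish. *)
elim: m t => // m IH t Pt; rewrite ltnS leq_eqVlt => /orP[/eqP e_m|]; last exact: IH.
have le_mD : (m <= D)%N by rewrite -e_m leq_subr.
pose y := \sum_(t | P r t && (m <= e t)%N) c t *: (g ^+ (e t - m) * u t).
have hy : y \is (3 * (D - m) + r).-homog.
  apply: rpred_sum => t' /andP[Pt' le_me]; apply: dhomogZ.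
  rewrite (_ : 3 * (D - m) + r = 3 * (e t' - m) + (3 * q t' + r))%N.
    exact: dhomogM (dhomogMn _ hg) (deg_u _ Pt').
  by rewrite addnA -mulnDr addnBAC // subnK.
have Igy : I (g ^+ m * y).
  move: Iw; rewrite (bigID (fun t => (m <= e t)%N)) /= [X in _ + X]big1 => [|t' /andP[Pt' lt_em]].
    rewrite addr0 mulr_sumr; congr I; apply: eq_bigr => t' /andP[_ le_me].
    by rewrite /w -{1}(subnKC le_me) exprD -scalerAr mulrA.
  by rewrite (IH t') ?scale0r // ltnNge.
have {Igy} Iy : I y.
  apply: (regular_exp idI satI hg reg_a _ hy Igy).
  by rewrite addnAC -mulnDr subnK // leq_add2l ltnW.
have := apolarI _ Iy; rewrite /y (bigID (fun t => e t == m)) /=.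
rewrite (_ : \sum_(t | _ && (e t != m)) _ = g * \sum_(t | P r t && (m <= e t)%N && (e t != m))
     c t *: (g ^+ (e t - m.+1) * u t)).
  rewrite /Ann diffactDl mulrC (Ann_mull _ (Ann_permanent_cubic a)) addr0.
  move=> AnnF; apply: (indep_u (3 * (D - m) + r)%N c _ t); first 1 last.
  - by case/andP: Pt.
  - have /andP[_ /eqP <-] := Pt; rewrite -e_m subKn // mulnC.
    by rewrite -divn_eq.
  rewrite /Ann -[RHS]AnnF; congr diffact; apply: eq_big => [t'|t' /andP[ut' /eqP ct']].
    apply/andP/andP => [[ut' /eqP ct']|[/andP[/andP[ut' /eqP r_t'] _] /eqP em]].
      have et' : e t' = m.
        by rewrite /e /q ct' mulnC divnMDl // divn_small // addn0 subKn.
      by rewrite /= ut' ct' mulnC modnMDl modn_small // et' leqnn !eqxx.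
    split=> //; apply/eqP; rewrite -r_t' -em subKn // mulnC; exact: divn_eq.
  have -> : e t' = m.
    by rewrite /e /q ct' mulnC divnMDl // divn_small // addn0 subKn.
  by rewrite subnn expr0 mul1r.
rewrite mulr_sumr; apply: eq_bigr => t' /andP[/andP[_ le_me] ne_em].
rewrite -scalerAr mulrA -exprS; congr (_ *: (g ^+ _ * _)).
by rewrite -subSn // ltn_neqAle eq_sym ne_em.
Qed.

End LowerBound.

(** * The number of unordered pairs of equicardinal subsets *)

Section Counting.
Variable n : nat.
Local Notation pairs := ({set 'I_n} * {set 'I_n})%type.

(** Vandermonde's convolution, because there are as many subsets of size n - d
    as of size d. *)
Lemma card_equicardinal :
  #|[set t : pairs | #|t.1| == #|t.2|]| = 'C(2 * n, n).
Proof.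
rewrite -sum1_card mul2n -addnn -binomial.Vandermonde.
rewrite (partition_big (fun t : pairs => inord #|t.1| : 'I_n.+1) predT) //=.
have le_n (A : {set 'I_n}) : (#|A| < n.+1)%N.
  by rewrite ltnS -[X in (_ <= X)%N]card_ord max_card.
apply: eq_bigr => d _; rewrite bin_sub -1?ltnS //.
rewrite -[X in 'C(X, _)]card_ord -card_draws -cardsX -sum1_card.
apply: eq_bigl => -[A B]; rewrite !inE /= -(inj_eq val_inj) /= inordK //.
by rewrite andbC; case: eqP => //= ->; rewrite eq_sym.
Qed.

(** Ordered pairs count each unordered pair twice, except for the 2 ^ n pairs
    with equal members. *)
Lemma card_upair : (2 * #|[pred t : pairs | upair t]| = 'C(2 * n, n) + 2 ^ n)%N.
Proof.
pose U := [set t : pairs | upair t].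
pose V := [set t : pairs | upair (t.2, t.1)].
have cU : #|[pred t : pairs | upair t]| = #|U| by rewrite cardsE.
have cV : #|V| = #|U|.
  have swapK : involutive (fun t : pairs => (t.2, t.1)) by case.
  rewrite -(card_imset U (inv_inj swapK)); congr #|pred_of_set _|.
  apply/setP => t; rewrite inE; apply/idP/imsetP => [ut|[t' ut' ->]].
    by exists (t.2, t.1); rewrite ?inE //; case: t {ut}.
  by move: ut'; rewrite inE; case: t'.
have UV : U :|: V = [set t : pairs | #|t.1| == #|t.2|].
  apply/setP => -[A B]; rewrite !inE /upair /= [#|B| == _]eq_sym -andb_orr.
  by rewrite leq_total andbT.
have UIV : #|U :&: V| = (2 ^ n)%N.
  rewrite -[X in (_ ^ X)%N]card_ord -[X in (2 ^ X)%N]cardsT -card_powerset powersetT.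
  have diag_inj : injective (fun A : {set 'I_n} => (A, A)) by move=> A B [].
  rewrite -(card_imset _ diag_inj); congr #|pred_of_set _|.
  apply/setP => -[A B]; rewrite !inE /upair /=; apply/idP/imsetP => [|[C _ [-> ->]]].
    case/andP=> /andP[_ leAB] /andP[_ leBA]; exists A; first by rewrite inE.
    suff -> : B = A by [].
    by apply: enum_rank_inj; apply/val_inj/anti_leq; rewrite /= leAB leBA.
  by rewrite eqxx leqnn.
by rewrite cU mul2n -addnn -{2}cV -cardsUI UV UIV card_equicardinal.
Qed.

End Counting.

(** * Smooth schemes are smoothable *)

Lemma exists_is_min (P : nat -> Prop) : (exists m, P m) -> exists m, is_min P m.
Proof.
case=> m; elim: m {-2}m (leqnn m) => [|w IH] m le_m Pm.
  by exists m; split=> // s _; move: le_m; rewrite leqn0 => /eqP ->.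
case: (classic (exists2 s, P s & (s < m)%N)) => [[s Ps lt_sm]|min_m].
  by apply: (IH s) => //; rewrite -ltnS (leq_trans lt_sm).
exists m; split=> // s Ps; rewrite leqNgt; apply/negP => lt_sm.
by apply: min_m; exists s.
Qed.

(** A smooth scheme is the special fibre of the constant family over the base
    field, whose generic fibre is its base change to the fraction field. *)
Lemma smooth_smoothable (k : fieldType) (N s : nat) (G : closed_subscheme k N) :
  zero_dim_of_degree G s -> smooth0 G -> smoothable G s.
Proof.
case=> _ [d0 Gs] smoothG.
have hG : homogeneous_ideal G by case: (G).
have idmpoly h : map_mpoly (idfun : k -> k) h = h.
  by apply/mpolyP => m; rewrite mcoeff_map_mpoly.
exists k, (idfun : {rmorphism k -> k}), (idfun : {rmorphism k -> k}), G, d0; split=> //.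
  move=> d _ h _; split=> [[r [a [g [Gg ->]]]]|Gh].
    by apply: ideal_sum => [|i _]; [case: hG|apply: idealMl; [case: hG|rewrite idmpoly]].
  exists 1, (fun=> 1), (fun=> h); split=> //.
  by rewrite big_ord1 mul1r idmpoly.
move=> L f p nz_p Gp v tv.
pose f' : {rmorphism k -> L} := f \o @FracField.tofrac k.
have mapE h : map_mpoly f (map_mpoly (@FracField.tofrac k) h) = map_mpoly f' h.
  by apply/mpolyP => m; rewrite !mcoeff_map_mpoly.
have ext h : G h -> extend_ideal (@FracField.tofrac k) G
    (map_mpoly (@FracField.tofrac k) h).
  move=> Gh; exists 1, (fun=> 1), (fun=> h); split=> //.
  by rewrite big_ord1 mul1r.
apply: (smoothG L f' p nz_p) => [h Gh|h Gh].
  by rewrite -mapE; apply: Gp; apply: ext.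
rewrite -[RHS](tv _ (ext h Gh)).
by apply: eq_bigr => i _; rewrite mapE.
Qed.

(** * Finite sets of rational points as smooth schemes *)

Section PointIdeal.
Variables (k : fieldType) (N : nat) (i0 : 'I_N).
Implicit Types (p q : {ffun 'I_N -> k}) (h P : {mpoly k[N]}) (pts : seq {ffun 'I_N -> k}).

(** Restriction of a polynomial to the line spanned by p, with coordinate 'X. *)
Definition on_line p : {mpoly k[N]} -> {poly k} :=
  mmap (@polyC k) (fun i => p i *: 'X).

Lemma on_line_homog p d h : h \is d.-homog -> on_line p h = h.@[p] *: 'X^d.
Proof.
move=> /dhomogP hh; rewrite /on_line /mmap mevalE scaler_suml.
rewrite big_seq [RHS]big_seq; apply: eq_bigr => m /hh /= <-.
rewrite mul_polyC -scalerA; congr (_ *: _); rewrite /mmap1.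
rewrite mdegE expr_sum -scaler_prod; apply: eq_bigr => i _.
exact: exprZn.
Qed.

Lemma on_line0 p : on_line p 0 = 0. Proof. exact: rmorph0. Qed.
Lemma on_lineD p g h : on_line p (g + h) = on_line p g + on_line p h.
Proof. exact: rmorphD. Qed.
Lemma on_lineM p g h : on_line p (g * h) = on_line p g * on_line p h.
Proof. exact: rmorphM. Qed.
Lemma on_lineZ p c h : on_line p (c *: h) = c *: on_line p h.
Proof. by rewrite /on_line mmapZ mul_polyC. Qed.

Lemma on_line_pihomog p d h :
  on_line p (pihomog mdeg d h) = (on_line p h)`_d *: 'X^d.
Proof.
elim/mpolyind: h => [|c m h _ _ IH].
  by rewrite pihomog0 on_line0 coef0 scale0r.
rewrite pihomogD linearZ !on_lineD /= IH coefD scalerDl pihomogX !on_lineZ coefZ.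
have hX : ('X_[m] : {mpoly k[N]}) \is (mdeg m).-homog by rewrite dhomogX /=.
rewrite (on_line_homog p hX) coefZ coefXn -scalerA; congr (_ *: _ + _).
have [<-|ne] := eqVneq (mdeg m) d; first by rewrite mulr1 (on_line_homog p hX).
by rewrite mulr0 scale0r on_line0.
Qed.

(** Homogeneous components are separated by the exponent of the coordinate on
    the lines, which makes this kernel of ring morphisms the homogeneous ideal
    of the points. *)
Definition point_ideal pts h := forall p, p \in pts -> on_line p h = 0.

Lemma point_ideal_homog pts d h : h \is d.-homog ->
  point_ideal pts h <-> {in pts, forall p, h.@[p] = 0}.
Proof.
move=> hh; split=> H p /H; rewrite (on_line_homog p hh); last by move=> ->; rewrite scale0r.
by move/eqP; rewrite scaler_eq0 -[X in _ || X]size_poly_eq0 size_polyXn orbF => /eqP.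
Qed.

Lemma point_ideal_homogeneous pts : homogeneous_ideal (point_ideal pts).
Proof.
split; first split=> [p _|g h Ig Ih p pp|g h Ih p pp].
- by rewrite on_line0.
- by rewrite on_lineD Ig // Ih // addr0.
- by rewrite on_lineM Ih // mulr0.
by move=> h Ih d p pp; rewrite on_line_pihomog Ih // coef0 scale0r.
Qed.

Variable pts : seq {ffun 'I_N -> k}.
Hypotheses (uniq_pts : uniq pts) (pts1 : {in pts, forall p, p i0 = 1}).

Lemma point_ideal_saturated : saturated (point_ideal pts).
Proof.
move=> h [e He] p pp; have hX : ('X_i0 : {mpoly k[N]}) \is 1.-homog.
  by rewrite dhomogX; apply/eqP/mdeg1.
have hXe : ('X_i0 ^+ e : {mpoly k[N]}) \is e.-homog.
  by rewrite -[X in X.-homog]mul1n; apply: dhomogMn.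
have := He _ hXe p pp; rewrite on_lineM (on_line_homog p hXe).
rewrite rmorphXn /= mevalXU pts1 // expr1n scale1r => /eqP.
by rewrite mulf_eq0 -size_poly_eq0 size_polyXn => /eqP.
Qed.

Definition point_scheme : closed_subscheme k N :=
  ClosedSubscheme (point_ideal_homogeneous pts) point_ideal_saturated.

(** The equations of the point q of the affine chart where coordinate i0 is 1. *)
Definition line_form q i : {mpoly k[N]} := 'X_i - q i *: 'X_i0.

Lemma line_form_homog q i : line_form q i \is 1.-homog.
Proof. by rewrite rpredB ?dhomogZ ?dhomogX //; apply/eqP/mdeg1. Qed.

Lemma meval_line_form q i p : (line_form q i).@[p] = p i - q i * p i0.
Proof. by rewrite mevalB mevalZ !mevalXU. Qed.

(** A product of linear forms, each vanishing at one point of s but not at p. *)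
Lemma exists_lagrange p (s : seq {ffun 'I_N -> k}) :
    p i0 = 1 -> {in s, forall q, q i0 = 1} -> p \notin s ->
  exists P, [/\ P \is (size s).-homog, {in s, forall q, P.@[q] = 0} & P.@[p] != 0].
Proof.
move=> p1; elim: s => [|q s IH] s1.
  by exists 1; split=> //; rewrite ?meval1 ?oner_eq0 //; exact: dhomog1.
rewrite inE negb_or => /andP[ne_pq ps].
have [|//|P [hP sP pP]] := IH; first by move=> r rs; apply: s1; rewrite inE rs orbT.
have [i ne_i] : exists i, p i != q i.
  by apply/existsP; apply: contraNT ne_pq => /existsPn e; apply/eqP/ffunP => i; apply/eqP/negPn.
exists (line_form q i * P); split.
- by rewrite /= -add1n dhomogM // line_form_homog.
- move=> r; rewrite inE mevalM => /orP[/eqP ->|rs]; last by rewrite sP ?mulr0.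
  by rewrite meval_line_form (s1 q) ?mem_head // mulr1 subrr mul0r.
by rewrite mevalM mulf_neq0 // meval_line_form p1 mulr1 subr_eq0.
Qed.

Lemma exists_lagrange_basis d : (size pts <= d)%N ->
  exists b : 'I_(size pts) -> {mpoly k[N]},
    (forall i, b i \is d.-homog) /\
    (forall i j, (b i).@[tnth (in_tuple pts) j] = (i == j)%:R).
Proof.
move=> le_d.
have /fin_all_exists[b Hb] (i : 'I_(size pts)) : exists b : {mpoly k[N]},
    b \is d.-homog /\ (forall j, b.@[tnth (in_tuple pts) j] = (i == j)%:R).
  set p := tnth (in_tuple pts) i.
  have pp : p \in pts by rewrite mem_tnth.
  have [||P [hP sP pP]] := @exists_lagrange p (rem p pts) (pts1 pp).
  - by move=> q /mem_rem /pts1.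
  - by rewrite mem_rem_uniq // !inE eqxx.
  (* The coordinate i0 is 1 at all points, so its powers adjust the degree. *)
  exists (P.@[p]^-1 *: ('X_i0 ^+ (d - size (rem p pts)) * P)); split.
    have le_s : (size (rem p pts) <= d)%N by rewrite size_rem // (leq_trans (leq_pred _)).
    rewrite dhomogZ // -[X in X.-homog](subnK le_s) dhomogM //.
    rewrite -[X in X.-homog]mul1n dhomogMn // dhomogX; apply/eqP/mdeg1.
  move=> j; rewrite mevalZ mevalM rmorphXn /= mevalXU pts1 ?mem_tnth // expr1n mul1r.
  have [<-|ne_ij] := eqVneq i j; first by rewrite mulVf.
  suff j_p : tnth (in_tuple pts) j \in rem p pts by rewrite (sP _ j_p) mulr0.
  rewrite mem_rem_uniq // inE mem_tnth andbT; apply: contraNneq ne_ij => e.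
  by have /tuple_uniqP inj_p : uniq (in_tuple pts) by []; rewrite (inj_p _ _ e).
by exists b; split=> i; case: (Hb i).
Qed.

Lemma point_scheme_zero_dim : (0 < size pts)%N ->
  zero_dim_of_degree point_scheme (size pts).
Proof.
move=> s_gt0; split=> //; exists (size pts) => d /exists_lagrange_basis[b [hb Hb]].
exists b; split=> // h hh.
have valE (c : {ffun 'I_(size pts) -> k}) j :
    (h - \sum_i c i *: b i).@[tnth (in_tuple pts) j]
    = h.@[tnth (in_tuple pts) j] - c j.
  rewrite mevalB [X in _ - X]raddf_sum (bigD1 j) //= mevalZ Hb eqxx mulr1 big1 ?addr0 //.
  by move=> i ne; rewrite mevalZ Hb (negPf ne) mulr0.
have homE (c : {ffun 'I_(size pts) -> k}) : h - \sum_i c i *: b i \is d.-homog.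
  by rewrite rpredB // rpred_sum // => i _; rewrite dhomogZ.
exists [ffun j => h.@[tnth (in_tuple pts) j]]; split.
  apply/(point_ideal_homog _ (homE _)) => p /(tnthP (in_tuple pts))[j ->].
  by rewrite valE ffunE subrr.
move=> c /(point_ideal_homog _ (homE _)) Hc; apply/ffunP => j; rewrite ffunE.
by apply/eqP; rewrite -subr_eq0 -valE Hc ?mem_tnth.
Qed.

Lemma meval_map_homog (L : fieldType) (f : {rmorphism k -> L}) d P p (z : 'I_N -> L) c :
    P \is d.-homog -> (forall i, z i = f (p i) * c) ->
  (map_mpoly f P).@[z] = c ^+ d * f P.@[p].
Proof.
move=> /dhomogP hP zE; rewrite [in LHS](mpolyE P) [map_mpoly _ _]rmorph_sum.
rewrite [LHS]rmorph_sum mevalE [f _]rmorph_sum mulr_sumr.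
apply: eq_big_seq => m /hP /= <-; rewrite /= map_mpolyZ map_mpolyX mevalZ mevalX.
rewrite rmorphM mulrCA rmorph_prod mdegE expr_sum -big_split /=; congr (_ * _).
by apply: eq_bigr => i _; rewrite zE rmorphXn exprMn mulrC.
Qed.

(** A zero of the ideal over an extension lies on one of the lines through
    the points, since otherwise a product of linear forms, one for each
    point, would not vanish there.  Near that line the scheme is cut out by
    the linear forms of the point. *)
Lemma point_scheme_smooth : smooth0 point_scheme.
Proof.
move=> L f z nz_z Iz v tv.
have mapX j : map_mpoly f ('X_j : {mpoly k[N]}) = 'X_j by rewrite map_mpolyX.
have map_line q i : map_mpoly f (line_form q i) = 'X_i - f (q i) *: 'X_i0.
  by rewrite rmorphB /= map_mpolyZ !mapX.
have eval_line q i : (map_mpoly f (line_form q i)).@[z] = z i - f (q i) * z i0.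
  by rewrite map_line mevalB mevalZ !mevalXU.
have [p pp zp] : exists2 p, p \in pts & forall i, z i = f (p i) * z i0.
  apply: NNPP => no_p.
  have sep (s : seq {ffun 'I_N -> k}) : {subset s <= pts} -> exists P,
      [/\ P \is (size s).-homog, {in s, forall q, P.@[q] = 0}
        & (map_mpoly f P).@[z] != 0].
    elim: s => [|q s IH] sub_s.
      exists 1; split=> //; first exact: dhomog1.
      by rewrite rmorph1 meval1 oner_eq0.
    have [|P [hP sP zP]] := IH; first by move=> r rs; apply: sub_s; rewrite inE rs orbT.
    have [i ne_i] : exists i, z i != f (q i) * z i0.
      apply/existsP; apply: contra_notT no_p => /existsPn e; exists q.
        by apply: sub_s; rewrite mem_head.
      by move=> i; apply/eqP/negPn.
    exists (line_form q i * P); split.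
    - by rewrite /= -add1n dhomogM // line_form_homog.
    - move=> r; rewrite inE mevalM => /orP[/eqP ->|rs]; last by rewrite sP ?mulr0.
      by rewrite meval_line_form pts1 ?sub_s ?mem_head // mulr1 subrr mul0r.
    by rewrite rmorphM /= mevalM mulf_neq0 // eval_line subr_eq0.
  have [//|P [hP sP zP]] := sep pts.
  by case/eqP: zP; apply: Iz; apply/(point_ideal_homog _ hP).
have nz_z0 : z i0 != 0.
  by case: nz_z => i; apply: contraNneq => z0; rewrite zp z0 mulr0.
have [||P [hP sP pP]] := @exists_lagrange p (rem p pts) (pts1 pp).
- by move=> q /mem_rem /pts1.
- by rewrite mem_rem_uniq // !inE eqxx.
have zP : (map_mpoly f P).@[z] != 0.
  rewrite (meval_map_homog hP zp).
  by rewrite mulf_neq0 ?expf_neq0 ?fmorph_eq0.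
exists (v i0 / z i0) => a; rewrite (zp a) mulrCA divfK //.
have hlP : line_form p a * P \is (1 + size (rem p pts)).-homog.
  by rewrite dhomogM ?line_form_homog.
have /tv : point_scheme (line_form p a * P).
  apply/(point_ideal_homog _ hlP) => q qp; rewrite mevalM.
  have [->|ne_qp] := eqVneq q p.
    by rewrite meval_line_form pts1 // mulr1 subrr mul0r.
  by rewrite sP ?mulr0 // mem_rem_uniq // inE ne_qp.
have termE i : v i * (map_mpoly f (line_form p a * P))^`M(i).@[z]
    = (v i * (a == i)%:R - f (p a) * (v i * (i0 == i)%:R)) * (map_mpoly f P).@[z].
  have dX (j : 'I_N) : (('X_j : {mpoly L[N]})^`M(i)).@[z] = (j == i)%:R.
    rewrite mderivX mnm1E; case: eqP => [->|_]; last by rewrite scale0r meval0.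
    by rewrite scale1r -[X in (X - _)%MM]add0m addmK mpolyX0 meval1.
  rewrite rmorphM /= mderivM mevalD !mevalM eval_line -(zp a) subrr mul0r addr0.
  rewrite map_line mderivB mderivZ mevalB mevalZ !dX.
  by ring.
under eq_bigr => i _ do rewrite termE.
rewrite -mulr_suml sumrB -mulr_sumr => /eqP.
have delta (j : 'I_N) : \sum_i v i * (j == i)%:R = v j.
  rewrite (bigD1 j) //= eqxx mulr1 big1 ?addr0 // => i ne.
  by rewrite eq_sym (negPf ne) mulr0.
by rewrite !delta mulf_eq0 (negPf zP) orbF subr_eq0 => /eqP ->.
Qed.

End PointIdeal.

(** * Existence of an apolar set of points *)

Section GenericPoints.

(** Uniqueness of digits in base M. *)
Lemma digits_inj N M (f g : 'I_N -> nat) :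
    (forall i, f i < M)%N -> (forall i, g i < M)%N ->
  (\sum_i f i * M ^ i = \sum_i g i * M ^ i)%N -> f =1 g.
Proof.
elim: N f g => [|N IH] f g ltf ltg; first by move=> _ [].
have step (h : 'I_N.+1 -> nat) : (\sum_i h i * M ^ i
    = (\sum_i h (lift ord0 i) * M ^ i) * M + h ord0)%N.
  rewrite big_ord_recl /= expn0 muln1 addnC big_distrl /=; congr (_ + _)%N.
  by apply: eq_bigr => i _; rewrite /bump add1n expnSr mulnA.
have M_gt0 : (0 < M)%N by apply: leq_trans (ltf ord0).
rewrite !step => e; have e0 : f ord0 = g ord0.
  have := congr1 (modn^~ M) e.
  by rewrite /= !modnMDl !modn_small.
have /IH {}IH : (\sum_i f (lift ord0 i) * M ^ i = \sum_i g (lift ord0 i) * M ^ i)%N.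
  apply/eqP; rewrite -(eqn_pmul2r M_gt0); move/eqP: e.
  by rewrite e0 eqn_add2r.
move=> i; case: (unliftP ord0 i) => [j ->|-> //].
by apply: IH => // j'.
Qed.

Variables (k : fieldType) (N : nat) (i0 : 'I_N).
Hypothesis k_infinite : forall t : seq k, exists x : k, x \notin t.

(** Along the curve t |-> (t ^ ((n + 1) ^ i))_i, with coordinate i0 replaced
    by 1, distinct monomials of the same degree at most n restrict to distinct
    powers of t, so a form that vanishes at sufficiently many points of the
    curve is zero. *)
Lemma exists_generic_points (n : nat) : exists pts : seq {ffun 'I_N -> k},
  [/\ uniq pts, (0 < size pts)%N, {in pts, forall p : {ffun 'I_N -> k}, p i0 = 1}
    & forall d (h : {mpoly k[N]}), (d <= n)%N -> h \is d.-homog ->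
        {in pts, forall p : {ffun 'I_N -> k}, h.@[p] = 0} -> h = 0].
Proof.
pose M := n.+1.
pose c i := if i == i0 then 0%N else (M ^ i)%N.
pose pt (t : k) : {ffun 'I_N -> k} := [ffun i => t ^+ c i].
pose wt (m : 'X_{1..N}) := (\sum_i m i * c i)%N.
pose W := (\sum_(i < N) n * c i)%N.
have [s us size_s] := infinite_uniq_seq k_infinite W.+1.
exists (undup (map pt s)); split; first exact: undup_uniq.
- case: s size_s {us} => // t s _; rewrite -has_predT; apply/hasP; exists (pt t) => //.
  by rewrite mem_undup mem_head.
- by move=> p; rewrite mem_undup => /mapP[t _ ->]; rewrite ffunE /c eqxx.
move=> d h le_dn /dhomogP hh h0.
have le_n m i : m \in msupp h -> (m i <= n)%N.
  move/hh => /= deg_m; apply: leq_trans le_dn; rewrite -deg_m mdegE.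
  by rewrite (bigD1 i) //= leq_addr.
have wt_inj : {in msupp h &, injective wt}.
  move=> m m' hm hm' eq_wt.
  (* The weight does not see the exponent of variable i0, which is recovered from
     the degree. *)
  pose dig (m : 'X_{1..N}) i := if i == i0 then 0%N else m i.
  have wtE m1 : wt m1 = (\sum_i dig m1 i * M ^ i)%N.
    by apply: eq_bigr => i _; rewrite /c /dig; case: eqP => _; rewrite ?muln0 ?mul0n.
  have lt_dig m1 : m1 \in msupp h -> forall i, (dig m1 i < M)%N.
    by move=> hm1 i; rewrite /dig; case: eqP => _ //; rewrite ltnS le_n.
  have eq_dig : dig m =1 dig m'.
    by apply: (@digits_inj N M); rewrite -?wtE //; apply: lt_dig.
  have eq_m i : i != i0 -> m i = m' i.
    by move=> ne; have := eq_dig i; rewrite /dig (negPf ne).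
  apply/mnmP => i; have [->|] := eqVneq i i0; last exact: eq_m.
  have := hh _ hm; rewrite -(hh _ hm') /= !mdegE (bigD1 i0) //= [RHS](bigD1 i0) //=.
  rewrite [X in (_ + X)%N](eq_bigr (fun i => m' i)) => [/addIn //|j]; exact: eq_m.
pose Q : {poly k} := \sum_(m <- msupp h) h@_m *: 'X^(wt m).
have rootQ t : t \in s -> Q.[t] = 0.
  move=> ts; rewrite -(h0 (pt t)) ?mem_undup ?map_f // mevalE horner_sum.
  apply: eq_bigr => m _; rewrite hornerZ hornerXn expr_sum; congr (_ * _).
  by apply: eq_bigr => i _; rewrite ffunE mulnC exprM.
have size_Q : (size Q <= W.+1)%N.
  rewrite /Q big_seq; apply: (leq_trans (size_sum _ _ _)); apply/bigmax_leqP_seq => m _ hm.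
  apply: leq_trans (size_scale_leq _ _) _; rewrite size_polyXn ltnS.
  by apply: leq_sum => i _; rewrite leq_mul2r le_n ?orbT.
have Q0 : Q = 0.
  apply/eqP; apply: contraT => nz_Q.
  have all_s : all (root Q) s by apply/allP => t /rootQ/eqP.
  by have := max_poly_roots nz_Q all_s us; rewrite size_s ltnNge size_Q.
apply/mpolyP => m; rewrite mcoeff0.
have [hm|/memN_msupp_eq0 //] := boolP (m \in msupp h).
have := congr1 (fun q : {poly k} => q`_(wt m)) Q0.
rewrite coef0 coef_sum (bigD1_seq m) ?msupp_uniq //= coefZ coefXn eqxx mulr1.
rewrite big_seq_cond big1 ?addr0 // => m' /andP[hm' ne]; rewrite coefZ coefXn.
by rewrite (inj_in_eq wt_inj) // eq_sym (negPf ne) mulr0.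
Qed.

(** A scheme of reduced points that lies on no hypersurface of degree at most
    the degree of F is apolar to F. *)
Lemma exists_smooth_apolar (n : nat) (F : {mpoly k[N]}) : F \is n.-homog ->
  exists s (G : closed_subscheme k N),
    [/\ zero_dim_of_degree G s, smooth0 G & apolar F G].
Proof.
move=> hF; have [pts [us s_gt0 pts1 nov]] := exists_generic_points n.
exists (size pts), (point_scheme pts1); split.
- exact: point_scheme_zero_dim.
- exact: point_scheme_smooth.
move=> h Gh; rewrite /Ann (pihomog_partitionE (leqnn (mmeasure mdeg h))) diffact_suml.
apply: big1 => d _; have hd := pihomogP mdeg d h.
have [lt_nd|le_dn] := ltnP n d.
  by apply: (Ann_gt_deg hF) => m /(dhomogP _ _ _ hd) /= ->.
rewrite (nov d _ le_dn hd) ?diffact0l //.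
apply/(point_ideal_homog _ hd).
by have [_] := point_ideal_homogeneous pts; apply.
Qed.

End GenericPoints.

(** * The ranks of the permanent *)

Lemma two_neq0 (k : fieldType) :
    [pchar k] =i pred0 \/ (exists2 p : nat, p \in [pchar k] & (2 < p)%N) ->
  2%:R != 0 :> k.
Proof.
case=> [char0|[p charp lt2p]].
  by have := char0 2; rewrite !inE /= => /negbT.
by rewrite -(dvdn_pcharf charp) gtnNdvd.
Qed.

Theorem theorem4p7 (k : fieldType) (n : nat)
    (k_infinite : forall t : seq k, exists x : k, x \notin t)
    (k_char : [pchar k] =i pred0 \/ exists2 p : nat, p \in [pchar k] & (2 < p)%N)
    (n_gt0 : (0 < n)%N) :
  exists c s r : nat,
    [/\ is_cactus_rank (permanent (generic_sym_mx k n)) c,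
        is_smoothable_rank (permanent (generic_sym_mx k n)) s,
        is_rank (permanent (generic_sym_mx k n)) r
      & [/\ (('C(2 * n, n) + 2 ^ n)%N%:R / 6%:R <= c%:R :> rat),
            (c <= s)%N
          & (s <= r)%N]].
Proof.
set F := permanent _.
have nz2 := two_neq0 k_char.
pose i := Ordinal n_gt0.
have [r0 Hr0] := exists_smooth_apolar (symvar i i) k_infinite (permanent_homog k n).
have [r minr] := exists_is_min (ex_intro (fun r => exists G : closed_subscheme k _,
  [/\ zero_dim_of_degree G r, smooth0 G & apolar F G]) r0 Hr0).
have Hs : exists G : closed_subscheme k #|{: symidx n}|,
    [/\ zero_dim_of_degree G r, smoothable G r & apolar F G].
  case: minr => [[G [dimG smG apG]] _]; exists G; split=> //.
  exact: smooth_smoothable.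
have [s mins] := exists_is_min (ex_intro (fun s => exists G : closed_subscheme k _,
  [/\ zero_dim_of_degree G s, smoothable G s & apolar F G]) r Hs).
have Hc : exists G : closed_subscheme k #|{: symidx n}|,
    zero_dim_of_degree G s /\ apolar F G.
  by case: mins => [[G [dimG _ apG]] _]; exists G.
have [c minc] := exists_is_min (ex_intro (fun c => exists G : closed_subscheme k _,
  zero_dim_of_degree G c /\ apolar F G) s Hc).
exists c, s, r; split=> //; split; last 2 first.
- by case: minc => _; apply.
- by case: mins => _; apply.
case: minc => [[[G [idG homG] satG] [[_ [d0 dimG]] apG]] _].
have le_3c := upair_leq_length k_infinite nz2 idG satG dimG apG.
rewrite ler_pdivrMr // -natrM ler_nat -card_upair.
by rewrite (leq_trans (leq_mul (leqnn 2) le_3c)) // mulnA mulnC.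
Qed.
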